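(* Suppose the training set $S=\{(\tilde{\mathbf x}_i,y_i)\}_{i=1}^n$ is generated by the $k$-cluster data model and satisfies assumptions (A1)-(A4) (both described in the context), and let $\theta$ be a KKT point (possibly depending on $S$) of the maximum margin problem $$\min_\theta \tfrac12\|\theta\|^2\quad\text{s.t. } y_i\,\mathcal N_\theta(\tilde{\mathbf x}_i)\ge 1\ \ \forall i\in[n],$$ where $\mathcal N_\theta$ is the two-layer ReLU network $\mathcal N_\theta(\tilde{\mathbf x})=\sum_{j=1}^w v_j\phi(\mathbf w_j^\top\tilde{\mathbf x}+b_j)$. Let $r\in[k]$ and let $\tilde{\mathbf x}\in\mathbb R^D$ be a nice example from cluster $r$, i.e. $\tilde{\mathbf x}=M\mathbf x+\zeta^{(r)}+\omega$ with $\mathbf x=\mu^{(r)}+\xi$, $\|\xi\|\le\sqrt2\ln d$, $\|\omega\|\le1$. Then, with probability at least $1-2\exp(-D/16)$ (over the cluster shifts $\zeta^{(1)},\dots,\zeta^{(k)}$), $\operatorname{sign}(\mathcal N_\theta(\tilde{\mathbf x}))=y^{(r)}$.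
   Context: Notation: $[m]=\{1,\dots,m\}$; $\|\cdot\|$ is the Euclidean norm. Data model. $D\ge d\ge1$ are integers, $g=D-d$, $k\ge2$ is the number of clusters, with labels $y^{(r)}\in\{-1,1\}$ and means $\mu^{(r)}\in\mathbb R^d$, $r\in[k]$. $M$ is a $D\times d$ matrix with orthonormal columns. The shifts $\zeta^{(1)},\dots,\zeta^{(k)}$ are independent $N(0,\tau^2I_D)$ vectors, $\tau>0$. The index set $[n]$ is partitioned into nonempty sets $I^{(1)},\dots,I^{(k)}$; for $i\in I^{(r)}$, $y_i=y^{(r)}$, $\mathbf x_i=\mu^{(r)}+\xi_i\in\mathbb R^d$ and $\tilde{\mathbf x}_i=M\mathbf x_i+\zeta^{(r)}+\omega_i\in\mathbb R^D$. No distribution is imposed on $\xi_i\in\mathbb R^d$ and $\omega_i\in\mathbb R^D$ beyond the norm bounds in (A3). Constants. $c_2=1+\sqrt2$; $\bar\zeta^2=1+2\tau\sqrt{13D/8}+13D\tau^2/8$ ($\bar\zeta>0$); $\Delta=2c_2\sqrt d\ln d$; $\epsilon_x=\bar\zeta^2+2\bar\zeta\sqrt d\,c_2$; $\Delta'=\Delta+\epsilon_x$; $p=\max_{i\ne j}|\langle\mu^{(i)},\mu^{(j)}\rangle|$. Assumptions. (A1) $\|\mu^{(r)}\|=\sqrt d$ for all $r\in[k]$. (A2) $k(p+\Delta'+1)=c'(d-\Delta'+1)$ for some $c'<1/10$. (A3) $\|\xi_i\|\le\sqrt2\ln d$ and $\|\omega_i\|\le1$ for all $i$. (A4) $c_3:=\frac{g\tau^2}{20k}-\frac{10k+1}{10k}\sqrt{\frac{13g\tau^2}{8}}>0$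 and $c_5:=\frac{d\tau^2}{20k}-\frac{10k+1}{10k}\sqrt{\frac{13d\tau^2}{8}}\,(\sqrt2\ln d+1)>0$. Network and KKT points. $\phi(x)=\max(0,x)$, and $\theta$ collects all $\mathbf w_j\in\mathbb R^D$, $b_j\in\mathbb R$, $v_j\in\mathbb R$, $j\in[w]$. $\theta$ is a KKT point of the maximum margin problem if there are $\lambda_i\ge0$ and $\phi'_{i,j}$ in the subdifferential of $\phi$ at $\mathbf w_j^\top\tilde{\mathbf x}_i+b_j$ (so $\phi'_{i,j}=1$ if this number is positive, $0$ if negative, in $[0,1]$ if zero) such that for all $j$: $\mathbf w_j=\sum_i\lambda_iy_iv_j\phi'_{i,j}\tilde{\mathbf x}_i$, $b_j=\sum_i\lambda_iy_iv_j\phi'_{i,j}$, $v_j=\sum_i\lambda_iy_i\phi(\mathbf w_j^\top\tilde{\mathbf x}_i+b_j)$; and for all $i$: $y_i\mathcal N_\theta(\tilde{\mathbf x}_i)\ge1$ and $\lambda_i(y_i\mathcal N_\theta(\tilde{\mathbf x}_i)-1)=0$.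
   Formalization: In (A2) the constant c' is taken to satisfy 0 < c' < 1/10 (equivalently d − Δ' + 1 > 0); a negative c' would make (A2) hold automatically whenever Δ' > d + 1, and the claim then fails for many clusters. *)

(* Defs.v *)
From HB Require Import structures.
From mathcomp Require Import all_boot all_order all_algebra.
From mathcomp Require Import all_classical all_reals all_analysis.

Set Implicit Arguments.
Unset Strict Implicit.
Unset Printing Implicit Defensive.

Import Order.TTheory GRing.Theory Num.Theory.

Local Open Scope ring_scope.

Section Euclidean.
Variable R : realType.

Definition dot (m : nat) (u v : 'cV[R]_m) : R := \sum_(i < m) u i 0 * v i 0.

(* The library norm `|u| on matrices is the sup norm, hence this definition. *)
Definition enorm (m : nat) (u : 'cV[R]_m) : R := Num.sqrt (dot u u).

End Euclidean.

Section Gaussian.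
Context (R : realType) (disp : measure_display) (T : measurableType disp).
Variable P : probability T R.

(* X ~ N(0, s^2 I_m), i.e. the law of X is the m-fold product of N(0, s^2),
   given by its values on boxes.  The second parameter of the library's
   normal_prob is the standard deviation, not the variance. *)
Definition isotropic_gaussian (m : nat) (s : R)
    (X : {RV P >-> m.-tuple (measurableTypeR R)}) : Prop :=
  forall B : 'I_m -> set (measurableTypeR R),
    (forall j, measurable (B j)) ->
    distribution P X [set x | forall j, B j (tnth x j)]%classic =
    (\prod_(j < m) normal_prob 0 s (B j))%E.

(* The product rule for proper subfamilies is the case A r = setT for the
   omitted indices. *)
Definition mutually_independent (k : nat) (d' : measure_display)
    (T' : measurableType d') (X : 'I_k -> {RV P >-> T'}) : Prop :=
  forall A : 'I_k -> set T',
    (forall r, measurable (A r)) ->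
    P [set t | forall r, A r (X r t)]%classic =
    (\prod_(r < k) P (X r @^-1` A r)%classic)%E.

End Gaussian.

Definition col_of_tuple (R : realType) (m : nat)
    (x : m.-tuple (measurableTypeR R)) : 'cV[R]_m :=
  \col_(j < m) (tnth x j : R).

Section Constants.
Variables (R : realType) (D d k : nat) (tau : R).

Definition c2 : R := 1 + Num.sqrt 2.

Definition zeta_bar : R :=
  Num.sqrt (1 + 2 * tau * Num.sqrt (13 * D%:R / 8) + 13 * D%:R * tau ^+ 2 / 8).

Definition Delta : R := 2 * c2 * Num.sqrt d%:R * ln d%:R.

Definition epsilon_x : R :=
  zeta_bar ^+ 2 + 2 * zeta_bar * Num.sqrt d%:R * c2.

Definition Delta' : R := Delta + epsilon_x.

(* All terms are nonnegative, so the default value 0 does not affect the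
   maximum as soon as k >= 2. *)
Definition max_corr (mu : 'I_k -> 'cV[R]_d) : R :=
  \big[Num.max/0]_(ij : 'I_k * 'I_k | ij.1 != ij.2)
     `|dot (mu ij.1) (mu ij.2)|.

(* The truncated subtraction is the true one since d <= D is assumed
   throughout. *)
Definition c3 : R :=
  let g : R := (D - d)%N%:R in
  g * tau ^+ 2 / (20 * k%:R)
  - (10 * k%:R + 1) / (10 * k%:R) * Num.sqrt (13 * g * tau ^+ 2 / 8).

Definition c5 : R :=
  d%:R * tau ^+ 2 / (20 * k%:R)
  - (10 * k%:R + 1) / (10 * k%:R) * Num.sqrt (13 * d%:R * tau ^+ 2 / 8)
    * (Num.sqrt 2 * ln d%:R + 1).

End Constants.

Record network (R : realType) (D w : nat) := Network {
  weight : 'I_w -> 'cV[R]_D ;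
  bias : 'I_w -> R ;
  outer : 'I_w -> R }.

Section Network.
Variables (R : realType) (D w : nat).

Definition relu (z : R) : R := Num.max 0 z.

Definition relu_subdiff (z s : R) : Prop :=
  [/\ 0 < z -> s = 1, z < 0 -> s = 0 & z = 0 -> 0 <= s <= 1].

Definition preact (theta : network R D w) (j : 'I_w) (x : 'cV[R]_D) : R :=
  dot (weight theta j) x + bias theta j.

Definition net_eval (theta : network R D w) (x : 'cV[R]_D) : R :=
  \sum_(j < w) outer theta j * relu (preact theta j x).

(* KKT points of  min 1/2 |theta|^2  s.t.  y_i N_theta(x_i) >= 1:  stationarity
   in each parameter (for the Clarke subdifferential of relu), primal and dual
   feasibility, complementary slackness. *)
Definition is_kkt (n : nat) (x : 'I_n -> 'cV[R]_D) (y : 'I_n -> R)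
    (theta : network R D w) : Prop :=
  exists (lambda : 'I_n -> R) (phi' : 'I_n -> 'I_w -> R),
    [/\ forall i, 0 <= lambda i,
        forall i j, relu_subdiff (preact theta j (x i)) (phi' i j),
        forall j,
          [/\ weight theta j =
                \sum_(i < n) (lambda i * y i * outer theta j * phi' i j) *: x i,
              bias theta j =
                \sum_(i < n) lambda i * y i * outer theta j * phi' i j
            & outer theta j =
                \sum_(i < n) lambda i * y i * relu (preact theta j (x i))],
        forall i, 1 <= y i * net_eval theta (x i)
      & forall i, lambda i * (y i * net_eval theta (x i) - 1) = 0].

End Network.

(* An example of a cluster with mean mu and shift zeta. *)
Definition example (R : realType) (D d : nat) (M : 'M[R]_(D, d))
    (mu : 'cV[R]_d) (zeta : 'cV[R]_D) (xi : 'cV[R]_d) (omega : 'cV[R]_D) :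
    'cV[R]_D :=
  M *m (mu + xi) + zeta + omega.

(* Main.v *)
(* On the event that every shift satisfies [|zeta|^2 <= 13 D tau^2 / 8], the
   Gram matrix of the examples is, up to [Delta'], that of the cluster means:
   with [A = d - Delta' + 1] and [B = p + Delta' + 1], two examples of the same
   cluster have inner product plus one at least [A], those of different clusters
   at most [B] in absolute value, and (A2) says [k B = c' A] with [c' < 1/10].
   At a KKT point let [S_s(q)] be the total mass [lambda_i v_j^2 phi'_ij] of the
   examples of cluster [q] on the neurons of output sign [s].  Complementary
   slackness, and the fact that an active neuron has nonnegative preactivation,
   bound all these masses by some [alpha] with [A alpha <= 1 + 2 c' A alpha];
   the margin constraint on one example of cluster [r] bounds [S_(y r)(r)] from
   below, and this dominates the interaction with the other clusters.

   The sharp Chernoff exponent of the chi-squared tail at 13/8 is slightly larger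
   than 1/16.  As (A2) forces [48 k <= sqrt D], the gain absorbs the factor [k] of
   the union bound over the clusters. *)

Require Import Defs.
From HB Require Import structures.
From mathcomp Require Import all_boot all_order all_algebra.
From mathcomp Require Import all_classical all_reals all_analysis.
From mathcomp Require Import measurable_realfun ring lra.

Set Implicit Arguments.
Unset Strict Implicit.
Unset Printing Implicit Defensive.

Import Order.TTheory GRing.Theory Num.Theory.

Local Open Scope ring_scope.

(** * Change of variables for nonnegative functions *)

Section DensityTransfer.
Local Open Scope classical_set_scope.
Local Open Scope ereal_scope.
Context d1 d2 (X : measurableType d1) (Y : measurableType d2) (R : realType).
Variables (mu : {measure set X -> \bar R}) (nu : {measure set Y -> \bar R}).

Import HBNNSimple.

(** The sets are the level sets of [f]. For [a] outside the range the level set is empty, so the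
    third clause holds for every [a], negative ones included. *)
Lemma nnsfun_sum_indic (f : {nnsfun Y >-> R}) :
  exists (s : seq R) (A : R -> set Y),
    [/\ forall a, measurable (A a),
        forall a, a \in s -> (0 <= a)%R,
        forall a y, (0 <= a * \1_(A a) y)%R
      & forall y, f y = (\sum_(a <- s) a * \1_(A a) y)%R].
Proof.
exists (finmap.enum_fset (fset_set (range f))), (fun a => f @^-1` [set a]).
split=> [a|a|a y|y]; first by [].
- by rewrite in_fset_set// inE => -[y _ <-]; exact: fun_ge0.
- by have := nnfun_muleindic_ge0 f a y; rewrite lee_fin.
- by rewrite fimfunE fsbig_finite.
Qed.

(** The pushforward along [phi] of the measure with density [h] is [c * nu] on sets, hence on simple
    functions by linearity and on nonnegative functions by monotone convergence. *)
Lemma ge0_integral_density (phi : X -> Y) (h : X -> R) (c : R)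
    (f : Y -> R) :
  measurable_fun setT phi -> measurable_fun setT h ->
  (forall x, (0 <= h x)%R) -> (0 <= c)%R ->
  (forall A, measurable A ->
     \int[mu]_x (h x * \1_A (phi x))%:E = c%:E * nu A) ->
  measurable_fun setT f -> (forall y, (0 <= f y)%R) ->
  \int[mu]_x (h x * f (phi x))%:E = c%:E * \int[nu]_y (f y)%:E.
Proof.
move=> mphi mh h0 c0 hA mf f0.
have mF : measurable_fun [set: Y] (EFin \o f) by exact/measurable_EFinP.
pose f_ := nnsfun_approx measurableT mF.
have cvf y : (f_ n y)%:E @[n --> \oo] --> (f y)%:E.
  by apply: (@cvg_nnsfun_approx _ _ _ _ measurableT _ mF) => // *; rewrite lee_fin.
have mhf (g : Y -> R) : measurable_fun setT g ->
    measurable_fun setT (fun x => (h x * g (phi x))%:E).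
  move=> mg; apply/measurable_EFinP; apply: measurable_funM => //.
  exact: measurableT_comp.
have mf_ n : measurable_fun setT (f_ n) by exact: measurable_funP.
have ndf_ y m n : (m <= n)%N -> (f_ m y <= f_ n y)%R.
  by move=> mn; exact/lefP/nd_nnsfun_approx.
have hf_ n : \int[mu]_x (h x * f_ n (phi x))%:E = \int[nu]_y (c%:E * (f_ n y)%:E).
  rewrite ge0_integralZl//; [|exact/measurable_EFinP|by move=> y _; rewrite lee_fin].
  have [s [A [mA s0 aA0 fE]]] := nnsfun_sum_indic (f_ n).
  have maA a : measurable_fun setT (fun y => a * \1_(A a) y : R)%R.
    by apply: measurable_funM => //; exact: measurable_indic.
  under eq_integral do rewrite fE mulr_sumr -sumEFin.
  under [in RHS]eq_integral do rewrite fE -sumEFin.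
  rewrite !ge0_integral_sum//; last first.
  - by move=> a x _; rewrite lee_fin mulr_ge0.
  - by move=> a; exact: (mhf _ (maA a)).
  - by move=> a y _; rewrite lee_fin.
  - by move=> a; apply/measurable_EFinP; exact: maA.
  rewrite ge0_sume_distrr; last first.
    by move=> a _; apply: integral_ge0 => y _; rewrite lee_fin.
  rewrite big_seq [RHS]big_seq; apply: eq_bigr => a /s0 a0.
  have mA' : measurable_fun setT (\1_(A a) : Y -> R) by exact: measurable_indic.
  under eq_integral do rewrite mulrCA EFinM.
  under [in RHS]eq_integral do rewrite EFinM.
  have := mhf _ mA'; move/measurable_EFinP: (mA') => {}mA' mhA.
  have hA0 x : setT x -> 0 <= (h x * \1_(A a) (phi x))%:E.
    by rewrite lee_fin mulr_ge0.
  have A0 y : setT y -> 0 <= (\1_(A a) y)%:E :> \bar R by rewrite lee_fin.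
  rewrite !ge0_integralZl//.
  by rewrite hA// integral_indic// setIT muleCA.
(* Monotone convergence on both sides of [hf_]. *)
transitivity (limn (fun n => \int[mu]_x (h x * f_ n (phi x))%:E)).
  rewrite -monotone_convergence//.
  - apply: eq_integral => x _; apply/esym/cvg_lim => //.
    under eq_fun do rewrite EFinM.
    by rewrite EFinM; apply: cvgeZl => //; exact: cvf.
  - by move=> n; exact: (mhf _ (mf_ n)).
  - by move=> n x _; rewrite lee_fin mulr_ge0.
  - by move=> x _ m n mn; rewrite lee_fin ler_wpM2l// ndf_.
under eq_fun do rewrite hf_.
rewrite -monotone_convergence//.
- rewrite -ge0_integralZl//; last by move=> y _; rewrite lee_fin.
  apply: eq_integral => y _; apply/cvg_lim => //.
  by apply: cvgeZl => //; exact: cvf.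
- by move=> n; apply: measurable_funeM; exact/measurable_EFinP.
- by move=> n y _; rewrite mule_ge0// lee_fin.
- by move=> y _ m n mn; rewrite lee_wpmul2l// lee_fin ndf_.
Qed.
End DensityTransfer.

(** * Expectation of a product, from the law on boxes *)

Section ProductExpectation.
Local Open Scope classical_set_scope.
Local Open Scope ereal_scope.
Context d1 d2 (T : measurableType d1) (Y : measurableType d2) (R : realType).
Variables (P : probability T R) (m : nat) (nu : 'I_m -> probability Y R).
Variable Z : 'I_m -> T -> Y.

(** Box probabilities are the case where every [g j] is an indicator. Indicators are then replaced
    by general functions one coordinate at a time, the other factors serving as a density. *)
Lemma integral_prod_of_boxes (g : 'I_m -> Y -> R) (c : 'I_m -> R) :
  (forall j, measurable_fun setT (Z j)) ->
  (forall B : 'I_m -> set Y, (forall j, measurable (B j)) ->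
     P [set t | forall j, B j (Z j t)] = \prod_(j < m) nu j (B j)) ->
  (forall j, measurable_fun setT (g j)) ->
  (forall j y, (0 <= g j y)%R) ->
  (forall j, \int[nu j]_y (g j y)%:E = (c j)%:E) ->
  \int[P]_t (\prod_(j < m) g j (Z j t))%:E = (\prod_(j < m) c j)%:E.
Proof.
move=> mZ boxP.
(* Induction on [l]: only the coordinates below [l] may carry a function that is not an
   indicator. *)
suff main l : (l <= m)%N -> forall (g : 'I_m -> Y -> R) (c : 'I_m -> R),
    (forall j, measurable_fun setT (g j)) ->
    (forall j y, (0 <= g j y)%R) ->
    (forall j, \int[nu j]_y (g j y)%:E = (c j)%:E) ->
    (forall j : 'I_m, (l <= j)%N -> exists2 A, measurable A & g j = \1_A) ->
    \int[P]_t (\prod_(j < m) g j (Z j t))%:E = (\prod_(j < m) c j)%:E.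
  move=> mg g0 gc; apply: (main m) => // j; by rewrite leqNgt ltn_ord.
elim: l => [_|l IH lm] {}g {}c mg g0 gc gA.
  have /choice[A AP] : forall j, exists A, measurable A /\ g j = \1_A.
    by move=> j; have [A mA ->] := gA j (leq0n j); exists A.
  have mB : measurable [set t | forall j, A j (Z j t)].
    rewrite (_ : mkset _ = \bigcap_(j in [set: 'I_m]) (Z j @^-1` A j)); last first.
      by apply/seteqP; split => t /= At j; [move=> _|]; exact: At.
    apply: fin_bigcap_measurable => // j _.
    by rewrite -[_ @^-1` _]setTI; apply: mZ => //; have [] := AP j.
  transitivity (\int[P]_t (\1_[set t | forall j, A j (Z j t)] t)%:E).
    apply: eq_integral => t _; congr _%:E.
    rewrite indicE; have [/set_mem /= At|/negP nAt] := boolP (t \in _).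
      by rewrite big1// => j _; rewrite (AP j).2 indicE mem_set.
    have [j nAj] : exists j, ~ A j (Z j t).
      by apply: contrapT => /forallNP nA; apply: nAt; apply/mem_set => j;
        apply: contrapT; exact: nA.
    by rewrite (bigD1 j)//= (AP j).2 indicE memNset// mul0r.
  have mA j : measurable (A j) by have [] := AP j.
  rewrite integral_indic// setIT.
  rewrite -[LHS]/(P _) -prodEFin; transitivity (\prod_(j < m) nu j (A j)).
    exact: boxP.
  apply: eq_bigr => j _; rewrite -gc (AP j).2.
  by rewrite integral_indic ?setIT//; have [] := AP j.
pose j0 := Ordinal lm.
pose h t := (\prod_(j < m | j != j0) g j (Z j t))%R.
have c_ge0 j : (0 <= c j)%R.
  by rewrite -lee_fin -gc; apply: integral_ge0 => y _; rewrite lee_fin.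
under eq_integral do rewrite (bigD1 j0)//= mulrC -/(h _).
rewrite (bigD1 j0)//= mulrC EFinM -gc.
apply: ge0_integral_density => //.
- rewrite /h; under eq_fun do rewrite -big_filter.
  by apply: measurable_prod => j _; exact: measurableT_comp.
- by move=> t; apply: prodr_ge0.
- by apply: prodr_ge0.
move=> A mA.
(* With an indicator at [j0], the induction hypothesis applies and yields the set-level identity
   required by the density lemma. *)
pose g' j := if j == j0 then \1_A else g j.
pose c' j := if j == j0 then fine (nu j0 A) else c j.
transitivity (\int[P]_t (\prod_(j < m) g' j (Z j t))%:E).
  apply: eq_integral => t _; rewrite [in RHS](bigD1 j0)//= mulrC /g' eqxx.
  congr (_ * _)%:E; apply: eq_bigr => j /negbTE -> //.
rewrite (IH (ltnW lm) g' c').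
- rewrite (bigD1 j0)//= mulrC EFinM {2}/c' eqxx fineK ?fin_num_measure//.
  by congr (_%:E * _); apply: eq_bigr => j /negbTE; rewrite /c' => ->.
- move=> j; rewrite /g'; case: ifP => // _; exact: measurable_indic.
- by move=> j y; rewrite /g'; case: ifP.
- move=> j; rewrite /g' /c'; case: eqP => [->|//].
  by rewrite integral_indic// setIT fineK ?fin_num_measure.
- move=> j lj; rewrite /g'; case: eqP => [_|/eqP jj0]; first by exists A.
  apply: gA; rewrite ltn_neqAle lj andbT; apply: contra jj0 => /eqP lE.
  by apply/eqP/val_inj.
Qed.

End ProductExpectation.

(** * Exponential moment of a squared Gaussian *)

Section GaussianTail.
Local Open Scope classical_set_scope.
Context (R : realType).

(** The moment generating function [(1 - 2 s)^(-1/2)] of the chi-squared law at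
    [s = (1 - a^-1) / 2]: the integrand times the density of standard deviation [tau] is [sqrt a]
    times the density of standard deviation [tau * sqrt a]. *)
Lemma integral_normal_expR_sqr (tau a : R) : 0 < tau -> 0 < a ->
  (\int[normal_prob 0 tau]_x (expR ((1 - a^-1) / 2 * (x / tau) ^+ 2))%:E =
   (Num.sqrt a)%:E)%E.
Proof.
move=> tau0 a0.
have mexp : measurable_fun [set: measurableTypeR R]
    (fun x : R => expR ((1 - a^-1) / 2 * (x / tau) ^+ 2)).
  apply: measurableT_comp => //; apply: measurable_funM => //.
  by apply: measurable_funX; apply: measurable_funM.
have sa0 : 0 < Num.sqrt a by rewrite sqrtr_gt0.
rewrite -[LHS]mul1e -(@ge0_integral_density _ _ _ _ _ lebesgue_measure _ id
  (normal_pdf 0 tau)) //; last first.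
- move=> A mA; rewrite mul1e /normal_prob.
  rewrite [RHS]integral_mkcond; apply: eq_integral => x _.
  rewrite patchE indicE; case: ifP => _; first by rewrite mulr1.
  by rewrite mulr0.
- by move=> x; exact: normal_pdf_ge0.
- exact: measurable_normal_pdf.
transitivity (\int[lebesgue_measure]_x
    ((Num.sqrt a)%:E * (normal_pdf 0 (tau * Num.sqrt a) x)%:E))%E.
  apply: eq_integral => x _; rewrite -EFinM; congr _%:E.
  rewrite !normal_pdfE ?gt_eqF ?mulr_gt0//.
  have -> : normal_peak tau = Num.sqrt a * normal_peak (tau * Num.sqrt a).
    rewrite /normal_peak -mulrnAr -[in RHS]mulrnAr (sqrtrM _ (sqr_ge0 tau)).
    rewrite (sqrtrM _ (sqr_ge0 (tau * _))).
    rewrite !sqrtr_sqr !gtr0_norm ?mulr_gt0// !invfM.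
    by rewrite mulrA mulrCA mulfV ?gt_eqF// mulr1.
  rewrite -mulrA -[LHS]mulrA -mulrA; congr (_ * (_ * _)).
  rewrite /normal_fun -expRD; congr expR.
  rewrite subr0 [(tau * _) ^+ 2]exprMn sqr_sqrtr ?ltW//.
  rewrite -[tau ^+ 2 *+ 2]mulr_natr -[(tau ^+ 2 * a) *+ 2]mulr_natr; field.
  by rewrite !gt_eqF.
rewrite ge0_integralZl//.
- by rewrite integral_normal_pdf mule1.
- by apply/measurable_EFinP; exact: measurable_normal_pdf.
- by move=> x _; rewrite lee_fin normal_pdf_ge0.
Qed.
End GaussianTail.

(** * Tail bound for the norms of the cluster shifts *)

Section GaussianNorm.
Local Open Scope classical_set_scope.
Context (R : realType) (disp : measure_display) (T : measurableType disp).
Context (P : probability T R) (D k : nat).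
Variable zeta : 'I_k -> {RV P >-> D.-tuple (measurableTypeR R)}.

Definition sqnorms_le (b : R) : set T := [set t | forall r,
  dot (col_of_tuple (zeta r t)) (col_of_tuple (zeta r t)) <= b].

Let mcoord r j : measurable_fun setT (fun t => tnth (zeta r t) j).
Proof.
by have /measurable_fun_tnthP := @measurable_funPT _ _ _ _ (zeta r); apply.
Qed.

Let dotE r t : dot (col_of_tuple (zeta r t)) (col_of_tuple (zeta r t)) =
  \sum_(j < D) (tnth (zeta r t) j : R) ^+ 2.
Proof. by apply: eq_bigr => j _; rewrite mxE expr2. Qed.

Lemma measurable_sqnorms_le b : measurable (sqnorms_le b).
Proof.
rewrite (_ : sqnorms_le b = \bigcap_(r in [set: 'I_k])
    [set t | \sum_(j < D) (tnth (zeta r t) j : R) ^+ 2 <= b]); last first.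
  apply/seteqP; split => t /= H; first by move=> r _; rewrite /= -dotE.
  by move=> r; rewrite dotE; exact: H.
apply: fin_bigcap_measurable => // r _.
rewrite -[X in measurable X]setTI.
apply: (@measurable_fun_le _ _ _ setT
  (fun t => \sum_(j < D) (tnth (zeta r t) j : R) ^+ 2) (cst b)) => //.
apply: (@measurable_sum _ _ _ _ _ _ (fun j t => (tnth (zeta r t) j : R) ^+ 2)).
by move=> j; apply: measurable_funX; exact: mcoord.
Qed.

(* Chernoff's bound for the chi-squared distribution with [D] degrees of
   freedom, at the optimal exponent. *)
Lemma probability_sqnorms_le (tau a : R) : 0 < tau -> 1 <= a ->
  (forall r, isotropic_gaussian tau (zeta r)) ->
  ((1 - k%:R * (Num.sqrt a * expR (- ((a - 1) / 2))) ^+ D)%:E <=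
   P (sqnorms_le (a * D%:R * tau ^+ 2)))%E.
Proof.
move=> tau0 a1 gauss; set E := sqnorms_le _.
have mE : measurable E by exact: measurable_sqnorms_le.
have a0 : 0 < a by rewrite (lt_le_trans _ a1).
set rho := Num.sqrt a * _.
(* With [s = (1 - a^-1) / 2], one has [s * a = (a - 1) / 2], so the product of [g] over the
   coordinates is [exp (s * (|zeta|^2 / tau^2 - a * D))], which is at least 1 once the norm bound
   fails. *)
pose u (x : R) : R := expR ((1 - a^-1) / 2 * (x / tau) ^+ 2).
pose g (x : R) : R := expR (- ((a - 1) / 2)) * u x.
have mu_ : measurable_fun [set: measurableTypeR R] u.
  apply: measurableT_comp => //; apply: measurable_funM => //.
  by apply: measurable_funX; apply: measurable_funM.
have mg : measurable_fun [set: measurableTypeR R] g.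
  exact: measurable_funM.
have g0 x : 0 <= g x by rewrite mulr_ge0// expR_ge0.
have intg : (\int[normal_prob 0 tau]_x (g x)%:E = rho%:E)%E.
  under eq_integral do rewrite EFinM.
  rewrite ge0_integralZl//.
  - by rewrite integral_normal_expR_sqr// -EFinM mulrC.
  - exact/measurable_EFinP.
  - by move=> x _; rewrite lee_fin expR_ge0.
have mG r : measurable_fun setT (fun t => \prod_(j < D) g (tnth (zeta r t) j)).
  apply: (@measurable_prod _ _ _ _ _ _ (fun j t => g (tnth (zeta r t) j))) => j _.
  exact: (measurableT_comp mg (mcoord r j)).
have intG r :
    (\int[P]_t (\prod_(j < D) g (tnth (zeta r t) j))%:E = (rho ^+ D)%:E)%E.
  transitivity (\prod_(j < D) rho)%:E; last by rewrite prodr_const card_ord.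
  apply: (@integral_prod_of_boxes _ _ _ _ _ P D (fun=> normal_prob 0 tau)
    (fun j t => tnth (zeta r t) j) (fun=> g)) => //.
  by move=> B mB; have := gauss r B mB.
(* Markov's inequality and the union bound together: the indicator of the complement is at most the
   sum over the clusters of these products. *)
have PEC : (P (~` E) <= (k%:R * rho ^+ D)%:E)%E.
  rewrite -[~` E]setIT -integral_indic//; last exact: measurableC.
  apply: (@le_trans _ _ (\int[P]_t
      (\sum_(r < k) (\prod_(j < D) g (tnth (zeta r t) j))%:E))%E).
    apply: ge0_le_integral => //.
    - apply/measurable_EFinP; apply: measurable_indic; exact: measurableC.
    - by apply: emeasurable_sum => r; apply/measurable_EFinP; exact: mG.
    move=> t _; rewrite indicE; have [/set_mem /= nEt|_] := boolP (t \in _);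
      last by apply: sume_ge0 => r _; rewrite lee_fin prodr_ge0.
    have [r Er] : exists r, ~ (dot (col_of_tuple (zeta r t))
        (col_of_tuple (zeta r t)) <= a * D%:R * tau ^+ 2).
      by apply/existsNP.
    rewrite (bigD1 r)//=; apply: (@le_trans _ _ (\prod_(j < D) g (tnth (zeta r t) j))%:E).
      rewrite lee_fin /g /u; under eq_bigr do rewrite -expRD.
      rewrite -expR_sum -[leLHS]expR0 ler_expR.
      rewrite big_split/= sumr_const card_ord -mulr_sumr.
      under eq_bigr do rewrite exprMn.
      rewrite -mulr_suml -dotE.
      move/negP: Er; rewrite -ltNge => /ltW; set S := dot _ _ => SE.
      rewrite -[_ *+ D]mulr_natr.
      have -> : (a - 1) / 2 = (1 - a^-1) / 2 * a by field; rewrite gt_eqF.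
      rewrite [leRHS](_ : _ = (1 - a^-1) / 2 * (S * tau^-1 ^+ 2 - a * D%:R));
        last by ring.
      rewrite mulr_ge0//.
        by rewrite divr_ge0// subr_ge0 invf_le1.
      by rewrite subr_ge0 exprVn ler_pdivlMr// exprn_gt0.
    by rewrite leeDl// sume_ge0// => i _; rewrite lee_fin prodr_ge0.
  rewrite ge0_integral_sum//.
  - under eq_bigr do rewrite intG.
    by rewrite sumEFin sumr_const card_ord mulr_natl.
  - by move=> r; apply/measurable_EFinP; exact: mG.
  - by move=> r t _; rewrite lee_fin prodr_ge0.
have := probability_setC P mE => PE.
move: PEC; rewrite PE -(fineK (fin_num_measure P E mE)) -EFinB !lee_fin.
by move=> ?; lra.
Qed.

End GaussianNorm.

(** * Numerical estimates for the failure probability *)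

Section UnionBoundConstant.
Context (R : realType).

(** Since [5/16 - 99/400 = 1/16 + 1/400], a factor [exp (- D / 400)] is left to absorb [k]. The
    proof starts from [1 + x <= exp x] at [x = 99/6400] and squares four times, rounding down to a
    fraction after each squaring. *)
Lemma sqrt_le_expR : Num.sqrt (13 / 8) <= expR (99 / 400) :> R.
Proof.
have sq (x y z : R) : 0 <= y -> y <= expR x -> z <= y ^+ 2 -> z <= expR (2 * x).
  move=> y0 yx zy; rewrite expRM_natl (le_trans zy)// lerXn2r// nnegrE.
  exact: expR_ge0.
have h0 : 1 + 99 / (64 * 100) <= expR (99 / (64 * 100)) :> R := expR_ge1Dx _.
have h1 : 1031 / 1000 <= expR (2 * (99 / (64 * 100))) :> R.
  by apply: sq h0 _; lra.
have h2 : 524 / 493 <= expR (2 * (2 * (99 / (64 * 100)))) :> R.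
  by apply: sq h1 _; lra.
have h3 : 61 / 54 <= expR (2 * (2 * (2 * (99 / (64 * 100))))) :> R.
  by apply: sq h2 _; lra.
have h4 : 319 / 250 <= expR (2 * (2 * (2 * (2 * (99 / (64 * 100)))))) :> R.
  by apply: sq h3 _; lra.
have <- : 2 * (2 * (2 * (2 * (99 / (64 * 100))))) = 99 / 400 :> R by lra.
have p0 : 0 <= 319 / 250 :> R by lra.
apply: le_trans h4; rewrite -(@ler_pXn2r _ 2) ?nnegrE ?sqrtr_ge0//.
by rewrite sqr_sqrtr; lra.
Qed.

(** Suffices [k <= 2 * exp (D / 400)], which follows from [exp x >= 1 + x] as [D] is at least
    [(48 k)^2]. *)
Lemma chernoff_union_bound (D k : nat) : (2 <= k)%N ->
  48 * k%:R <= Num.sqrt D%:R :> R ->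
  k%:R * (Num.sqrt (13 / 8) * expR (- ((13 / 8 - 1) / 2))) ^+ D <=
  2 * expR (- (D%:R / 16)) :> R.
Proof.
move=> k2 kD.
have k2' : 2 <= k%:R :> R by rewrite ler_nat.
apply: (@le_trans _ _ (k%:R * (expR (- (D%:R / 400)) * expR (- (D%:R / 16))))).
  rewrite ler_wpM2l// -expRD.
  rewrite (_ : - _ - _ = D%:R * (99 / 400 + - ((13 / 8 - 1) / 2))); last by lra.
  rewrite expRM_natl lerXn2r ?nnegrE ?expR_ge0 ?mulr_ge0 ?sqrtr_ge0 ?expR_ge0//.
  by rewrite expRD ler_wpM2r ?expR_ge0// sqrt_le_expR.
rewrite mulrA ler_wpM2r ?expR_ge0// expRN ler_pdivrMr ?expR_gt0//.
apply: (@le_trans _ _ (2 * (1 + D%:R / 400))); last by rewrite ler_wpM2l// expR_ge1Dx.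
have DE : D%:R = Num.sqrt D%:R ^+ 2 :> R by rewrite sqr_sqrtr.
by rewrite [in leRHS]DE; nra.
Qed.

End UnionBoundConstant.

(** * Margins at KKT points for nearly orthogonal clusters *)

Section ClusterKKT.
Context (R : realType) (D w n k : nat).
Variables (x : 'I_n -> 'cV[R]_D) (cl : 'I_n -> 'I_k) (y : 'I_k -> R).
Variables (theta : network R D w) (lambda : 'I_n -> R) (phi' : 'I_n -> 'I_w -> R).
Variables (A B C : R).

(* The Gram entries of [z] with the examples, plus one for the bias, when [z]
   looks like an example of cluster [q]. *)
Definition gram_near (q : 'I_k) (z : 'cV[R]_D) : Prop := forall i,
  if cl i == q then A <= dot (x i) z + 1 <= C else `|dot (x i) z + 1| <= B.

Hypothesis y1 : forall q, y q = 1 \/ y q = -1.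
Hypothesis lambda_ge0 : forall i, 0 <= lambda i.
Hypothesis subdiff : forall i j, relu_subdiff (preact theta j (x i)) (phi' i j).
Hypothesis weightE : forall j, weight theta j =
  \sum_(i < n) (lambda i * y (cl i) * outer theta j * phi' i j) *: x i.
Hypothesis biasE : forall j, bias theta j =
  \sum_(i < n) lambda i * y (cl i) * outer theta j * phi' i j.
Hypothesis A_gt0 : 0 < A.
Hypothesis B_ge0 : 0 <= B.
Hypothesis C_ge0 : 0 <= C.

Let v := outer theta.

(** The square comes from multiplying the stationarity equation by [v j]; it leaves the label as the
    only source of sign. *)
Definition neuron_mass (j : 'I_w) (q : 'I_k) : R :=
  \sum_(i < n | cl i == q) lambda i * v j ^+ 2 * phi' i j.

(** Here [s] is 1 or -1. Neurons with [v j = 0] are left out; they add nothing to the output. *)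
Definition signed_mass (s : R) (q : 'I_k) : R :=
  \sum_(j < w | 0 < s * v j) neuron_mass j q.

Lemma slope_ge0 i j : 0 <= phi' i j.
Proof.
have [h1 h2 h3] := subdiff i j.
have [/h2->//|/h1->//|/h3/andP[]//] := ltgtP (preact theta j (x i)) 0.
Qed.

Lemma influence_ge0 i j : 0 <= lambda i * v j ^+ 2 * phi' i j.
Proof. by rewrite mulr_ge0 ?slope_ge0// mulr_ge0 ?sqr_ge0. Qed.

Lemma neuron_mass_ge0 j q : 0 <= neuron_mass j q.
Proof.
by apply: sumr_ge0 => i _; exact: influence_ge0.
Qed.

Lemma signed_mass_ge0 s q : 0 <= signed_mass s q.
Proof. by apply: sumr_ge0 => j _; exact: neuron_mass_ge0. Qed.

Lemma ysqr q : y q * y q = 1.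
Proof. by have [->|->] := y1 q; rewrite ?mulrNN mulr1. Qed.

Lemma outer_preactE j z : v j * preact theta j z =
  \sum_(i < n) y (cl i) * (lambda i * v j ^+ 2 * phi' i j) * (dot (x i) z + 1).
Proof.
rewrite /preact weightE biasE.
have -> : dot (\sum_(i < n) (lambda i * y (cl i) * outer theta j * phi' i j) *: x i) z
    = \sum_(i < n) (lambda i * y (cl i) * outer theta j * phi' i j) * dot (x i) z.
  rewrite /dot; under eq_bigr do rewrite summxE mulr_suml.
  rewrite exchange_big/=; apply: eq_bigr => i _; rewrite mulr_sumr.
  by apply: eq_bigr => l _; rewrite mxE mulrA.
rewrite -big_split mulr_sumr; apply: eq_bigr => i _ /=; rewrite -/v; ring.
Qed.

Lemma split_clusters (q : 'I_k) (F : 'I_n -> R) :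
  \sum_i F i = \sum_(i | cl i == q) F i +
    \sum_(p | p != q) \sum_(i | cl i == p) F i.
Proof.
rewrite (partition_big cl predT)//= (bigD1 q)//=.
Qed.

(** Cluster [q] enters with sign [y q * y q = 1], so its Gram bounds apply directly; the other
    clusters have arbitrary signs and are bounded in absolute value. *)
Lemma outer_preact_bounds j q z : gram_near q z ->
  A * neuron_mass j q - B * \sum_(p | p != q) neuron_mass j p
    <= y q * (v j * preact theta j z)
    <= C * neuron_mass j q + B * \sum_(p | p != q) neuron_mass j p.
Proof.
move=> near; rewrite outer_preactE (split_clusters q) mulrDr.
set own := y q * \sum_(i | cl i == q) _; set oth := y q * _.
have ownE : own = \sum_(i | cl i == q)
    (lambda i * v j ^+ 2 * phi' i j) * (dot (x i) z + 1).
  rewrite /own mulr_sumr; apply: eq_bigr => i /eqP ->.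
  by rewrite !mulrA ysqr mul1r.
have /andP[own1 own2] : A * neuron_mass j q <= own <= C * neuron_mass j q.
  rewrite ownE /neuron_mass !mulr_sumr; apply/andP; split; apply: ler_sum => i iq;
    have := near i; rewrite iq => /andP[? ?]; rewrite mulrC.
    by rewrite ler_wpM2l ?influence_ge0.
  by rewrite ler_wpM2r ?influence_ge0.
have oth_le : `|oth| <= B * \sum_(p | p != q) neuron_mass j p.
  have yq : `|y q| = 1 by have [->|->] := y1 q; rewrite ?normrN normr1.
  rewrite /oth normrM yq mul1r (le_trans (ler_norm_sum _ _ _))// mulr_sumr.
  apply: ler_sum => p pq; rewrite (le_trans (ler_norm_sum _ _ _))//.
  rewrite /neuron_mass mulr_sumr; apply: ler_sum => i /eqP ip.
  have yp : `|y p| = 1 by have [->|->] := y1 p; rewrite ?normrN normr1.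
  rewrite normrM [X in X * _]normrM ip yp mul1r (ger0_norm (influence_ge0 i j)) mulrC ler_wpM2r ?influence_ge0//.
  by have := near i; rewrite ip (negbTE pq).
move: oth_le; rewrite ler_norml => /andP[? ?].
by apply/andP; split; lra.
Qed.

Lemma outer_relu_own j q z : gram_near q z -> 0 < y q * v j ->
  A * neuron_mass j q - B * \sum_(p | p != q) neuron_mass j p
    <= y q * (v j * relu (preact theta j z))
    <= C * neuron_mass j q + B * \sum_(p | p != q) neuron_mass j p.
Proof.
move=> near yv; have /andP[lo up] := outer_preact_bounds j near.
have s0 : 0 <= \sum_(p | p != q) neuron_mass j p.
  by apply: sumr_ge0 => p _; exact: neuron_mass_ge0.
have a0 := neuron_mass_ge0 j q.
move: lo up; rewrite !mulrA /relu => lo up; rewrite maxr_pMr ?(ltW yv)// mulr0.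
rewrite le_max lo orbT/= ge_max up andbT.
by rewrite addr_ge0// mulr_ge0.
Qed.

Lemma outer_relu_opposite j q z : gram_near q z -> 0 < - y q * v j ->
  - (B * \sum_(p | p != q) neuron_mass j p)
    <= y q * (v j * relu (preact theta j z)) <= 0.
Proof.
move=> near yv; have /andP[lo up] := outer_preact_bounds j near.
have s0 : 0 <= \sum_(p | p != q) neuron_mass j p.
  by apply: sumr_ge0 => p _; exact: neuron_mass_ge0.
have a0 := neuron_mass_ge0 j q.
have Aa0 : 0 <= A * neuron_mass j q by rewrite mulr_ge0// ltW.
have Bs0 : 0 <= B * \sum_(p | p != q) neuron_mass j p by rewrite mulr_ge0.
rewrite /relu mulrA; have [pos|neg] := lerP 0 (preact theta j z).
  by move: lo up; rewrite mulrA => lo up; apply/andP; split; nra.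
by rewrite mulr0 lexx andbT oppr_le0.
Qed.

Lemma margin_split q z :
  y q * net_eval theta z =
    \sum_(j < w | 0 < y q * v j) y q * (v j * relu (preact theta j z)) +
    \sum_(j < w | 0 < - y q * v j) y q * (v j * relu (preact theta j z)).
Proof.
rewrite /net_eval mulr_sumr (bigID (fun j => 0 < y q * v j))/=; congr (_ + _).
rewrite (bigID (fun j => 0 < - y q * v j))/= [X in _ + X]big1 ?addr0.
  apply: eq_bigl => j; rewrite mulNr oppr_gt0.
  by case: ltgtP.
move=> j /andP[]; rewrite mulNr oppr_gt0 -!leNgt => yv1 yv2.
have /eqP : y q * v j = 0 by apply/eqP; rewrite eq_le yv1 yv2.
by rewrite mulrA => /eqP ->; rewrite mul0r.
Qed.

Lemma exchange_mass s q :
  \sum_(j < w | 0 < s * v j) \sum_(p | p != q) neuron_mass j p =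
  \sum_(p | p != q) signed_mass s p.
Proof. by rewrite exchange_big. Qed.

Lemma margin_bounds q z : gram_near q z ->
  A * signed_mass (y q) q - B * \sum_(p | p != q) signed_mass (y q) p
    - B * \sum_(p | p != q) signed_mass (- y q) p <= y q * net_eval theta z
  /\ y q * net_eval theta z <=
    C * signed_mass (y q) q + B * \sum_(p | p != q) signed_mass (y q) p.
Proof.
move=> near; rewrite margin_split -!exchange_mass /signed_mass.
split.
  rewrite !mulr_sumr -sumrB -sumrN; apply: lerD; apply: ler_sum => j yv.
    by have /andP[] := outer_relu_own near yv.
  by have /andP[] := outer_relu_opposite near yv.
rewrite !mulr_sumr -big_split/= -[leRHS]addr0; apply: lerD.
  by apply: ler_sum => j yv; have /andP[] := outer_relu_own near yv.
by apply: sumr_le0 => j yv; have /andP[] := outer_relu_opposite near yv.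
Qed.

Hypothesis gram_x : forall i, gram_near (cl i) (x i).
Hypothesis feasible : forall i, 1 <= y (cl i) * net_eval theta (x i).
Hypothesis slack : forall i, lambda i * (y (cl i) * net_eval theta (x i) - 1) = 0.

(* A neuron with output weight of sign [- y q] that is active on an example of
   cluster [q] has a nonnegative preactivation there, to which cluster [q]
   itself contributes negatively. *)
Lemma opposite_mass_le q :
  A * signed_mass (- y q) q <= B * \sum_(p | p != q) signed_mass (- y q) p.
Proof.
rewrite -exchange_mass /signed_mass !mulr_sumr; apply: ler_sum => j yv.
have s0 : 0 <= \sum_(p | p != q) neuron_mass j p.
  by apply: sumr_ge0 => p _; exact: neuron_mass_ge0.
have [/existsP[i /andP[/eqP iq phi0]]|/existsPn none] :=
    boolP [exists i, (cl i == q) && (phi' i j != 0)].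
  have near : gram_near q (x i) by rewrite -iq.
  have /andP[lo _] := outer_preact_bounds j near.
  have pre0 : 0 <= preact theta j (x i).
    rewrite leNgt; apply/negP => neg; have [_ h _] := subdiff i j.
    by move/eqP: phi0; apply; exact: h.
  by move: lo; rewrite mulrA => lo; nra.
rewrite [X in A * X]big1 ?mulr0 ?mulr_ge0// => i iq.
by have := none i; rewrite iq/= negbK => /eqP ->; rewrite mulr0.
Qed.

(** If some example of cluster [q] has a nonzero multiplier, its margin is exactly 1 by
    complementary slackness and the lower margin bound applies; otherwise the mass vanishes. *)
Lemma own_mass_le q :
  A * signed_mass (y q) q <= 1 + B * \sum_(p | p != q) signed_mass (y q) p
    + B * \sum_(p | p != q) signed_mass (- y q) p.
Proof.
have [/existsP[i /andP[/eqP iq lam0]]|/existsPn none] :=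
    boolP [exists i, (cl i == q) && (lambda i != 0)].
  have near : gram_near q (x i) by rewrite -iq.
  have [lo _] := margin_bounds near.
  have := slack i; rewrite iq => /eqP; rewrite mulf_eq0 (negbTE lam0)/=.
  by rewrite subr_eq0 => /eqP N1; lra.
have -> : signed_mass (y q) q = 0.
  apply: big1 => j _; apply: big1 => i iq.
  by have := none i; rewrite iq/= negbK => /eqP ->; rewrite !mul0r.
have pos s : 0 <= B * \sum_(p | p != q) signed_mass s p.
  by rewrite mulr_ge0// sumr_ge0// => p _; exact: signed_mass_ge0.
by have := pos (y q); have := pos (- y q); lra.
Qed.

(** With [X = A * alpha], the bound [X <= 1 + 2 c X] gives [c X <= 1/8]. Feasibility gives
    [1 <= (1 + c) A S + c X] for the own mass [S] of cluster [r], so [A S] exceeds 3/4, while the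
    interference at [z] is at most [2 c X <= 1/4]. *)
Lemma kkt_margin_gt0 (c : R) (r : 'I_k) (z : 'cV[R]_D) :
  0 <= c < 1 / 10 -> k%:R * B = c * A -> C <= (1 + c) * A ->
  (exists i, cl i = r) -> gram_near r z -> 0 < y r * net_eval theta z.
Proof.
move=> /andP[c0 c1] kB CA [i ir] near.
(* Booleans encode the signs, so that the largest mass is taken over a finite type. *)
pose sgn (b : bool) : R := if b then 1 else -1.
pose F (p : bool * 'I_k) := signed_mass (sgn p.1) p.2.
case: (Order.TotalTheory.arg_maxP F (erefl : predT (true, r))) => -[b q] _ qmax.
set alpha := F (b, q) in qmax.
have alpha0 : 0 <= alpha by exact: signed_mass_ge0.
have le_alpha p p' : signed_mass (y p) p' <= alpha /\ signed_mass (- y p) p' <= alpha.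
  have h b' := qmax (b', p') isT; have ht := h true; have hf := h false.
  by have [->|->] := y1 p; rewrite ?opprK; split.
(* At most [k] terms, each at most [alpha], and [k * B = c * A]. *)
have sum_le s p : (forall p', signed_mass s p' <= alpha) ->
    B * \sum_(p' | p' != p) signed_mass s p' <= c * (A * alpha).
  move=> sa; rewrite mulrA -kB -mulrA [leRHS]mulrCA ler_wpM2l//.
  apply: (@le_trans _ _ (\sum_(p' | p' != p) alpha)); first exact: ler_sum.
  apply: (@le_trans _ _ (\sum_(p' < k) alpha)).
    by rewrite [leRHS](bigD1 p)//= lerDr.
  by rewrite sumr_const card_ord mulr_natl.
have sum_own p p' := sum_le _ p' (fun p'' => (le_alpha p p'').1).
have sum_opp p p' := sum_le _ p' (fun p'' => (le_alpha p p'').2).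
have Aa0 : 0 <= A * alpha by rewrite mulr_ge0// ltW.
have cX : c * (A * alpha) <= 1 / 10 * (A * alpha) by rewrite ler_wpM2r// ltW.
have Aa : A * alpha <= 1 + 2 * (c * (A * alpha)).
  have [bq|bq] : sgn b = y q \/ sgn b = - y q.
    by rewrite /sgn; case: b {alpha qmax alpha0 le_alpha sum_le sum_own sum_opp Aa0 cX};
      have [->|->] := y1 q; rewrite ?opprK; tauto.
  - have aE : signed_mass (y q) q = alpha by rewrite /alpha /F /= bq.
    by have := own_mass_le q; rewrite aE;
      have := sum_own q q; have := sum_opp q q; lra.
  - have aE : signed_mass (- y q) q = alpha by rewrite /alpha /F /= bq.
    by have := opposite_mass_le q; rewrite aE; have := sum_opp q q; lra.
have nearx : gram_near r (x i) by rewrite -ir.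
have [_ up] := margin_bounds nearx.
have [lo _] := margin_bounds near.
have N1 := feasible i; rewrite ir in N1.
have S0 := signed_mass_ge0 (y r) r.
have AS0 : 0 <= A * signed_mass (y r) r by rewrite mulr_ge0// ltW.
have CS : C * signed_mass (y r) r <= (1 + c) * (A * signed_mass (y r) r).
  by rewrite mulrA ler_wpM2r.
have cS : c * (A * signed_mass (y r) r) <= 1 / 10 * (A * signed_mass (y r) r).
  by rewrite ler_wpM2r// ltW.
have := sum_own r r; have := sum_opp r r; lra.
Qed.

End ClusterKKT.

(** * Euclidean inner product and norm *)

Section EuclideanTheory.
Context (R : realType).

Lemma dotC m (u v : 'cV[R]_m) : dot u v = dot v u.
Proof. by apply: eq_bigr => i _; rewrite mulrC. Qed.

Lemma dotDl m (u u' v : 'cV[R]_m) : dot (u + u') v = dot u v + dot u' v.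
Proof.
by rewrite /dot -big_split; apply: eq_bigr => i _; rewrite mxE mulrDl.
Qed.

Lemma dotDr m (u v v' : 'cV[R]_m) : dot u (v + v') = dot u v + dot u v'.
Proof. by rewrite dotC dotDl !(dotC u). Qed.

Lemma dotZl m a (u v : 'cV[R]_m) : dot (a *: u) v = a * dot u v.
Proof.
by rewrite /dot mulr_sumr; apply: eq_bigr => i _; rewrite mxE mulrA.
Qed.

Lemma dotZr m a (u v : 'cV[R]_m) : dot u (a *: v) = a * dot u v.
Proof. by rewrite dotC dotZl dotC. Qed.

Lemma dot_ge0 m (u : 'cV[R]_m) : 0 <= dot u u.
Proof. by apply: sumr_ge0 => i _; rewrite -expr2 sqr_ge0. Qed.

Lemma enorm_ge0 m (u : 'cV[R]_m) : 0 <= enorm u.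
Proof. exact: sqrtr_ge0. Qed.

Lemma sqr_enorm m (u : 'cV[R]_m) : enorm u ^+ 2 = dot u u.
Proof. by rewrite sqr_sqrtr// dot_ge0. Qed.

Lemma enorm_eq0 m (u : 'cV[R]_m) : enorm u = 0 -> u = 0.
Proof.
move=> u0; have := sqr_enorm u; rewrite u0 expr0n/= => /esym/eqP.
rewrite psumr_eq0 => [/allP h|i _]; last by rewrite -expr2 sqr_ge0.
apply/colP => i; rewrite mxE; apply/eqP.
by have := h i (mem_index_enum i); rewrite /= -expr2 sqrf_eq0.
Qed.

Lemma enormN m (u : 'cV[R]_m) : enorm (- u) = enorm u.
Proof. by rewrite -scaleN1r /enorm dotZl dotZr !mulN1r opprK. Qed.

(** Cauchy-Schwarz, by expanding the square of [|v| u - |u| v]; the vanishing norms are treated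
    apart to allow division by [|u| |v|]. *)
Lemma dot_le_enorm m (u v : 'cV[R]_m) : dot u v <= enorm u * enorm v.
Proof.
have [/eqP|a0] := eqVneq (enorm u) 0.
  move/eqP => /enorm_eq0 ->; rewrite -(scale0r u) dotZl mul0r.
  by rewrite mulr_ge0// enorm_ge0.
have [/eqP|b0] := eqVneq (enorm v) 0.
  move/eqP => /enorm_eq0 ->; rewrite -(scale0r v) dotZr mul0r.
  by rewrite mulr_ge0// enorm_ge0.
have ab : 0 < enorm u * enorm v.
  by rewrite mulr_gt0// lt_neqAle eq_sym ?a0 ?b0 enorm_ge0.
have := dot_ge0 (enorm v *: u + (- enorm u) *: v).
rewrite dotDl !dotDr !dotZl !dotZr -!sqr_enorm (dotC v u) => h.
rewrite -subr_ge0 -(pmulr_rge0 _ ab); nra.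
Qed.

Lemma normr_dot_le m (u v : 'cV[R]_m) : `|dot u v| <= enorm u * enorm v.
Proof.
rewrite ler_norml dot_le_enorm andbT lerNl.
by rewrite -mulN1r -dotZl scaleN1r -(enormN u) dot_le_enorm.
Qed.

Lemma enormD m (u v : 'cV[R]_m) : enorm (u + v) <= enorm u + enorm v.
Proof.
rewrite -(@ler_pXn2r _ 2)// ?nnegrE ?addr_ge0 ?enorm_ge0//.
rewrite sqr_enorm dotDl !dotDr (dotC v u) -!sqr_enorm.
by have := dot_le_enorm u v; nra.
Qed.

Lemma dot_isometry D d (M : 'M[R]_(D, d)) (u v : 'cV[R]_d) :
  M^T *m M = 1%:M -> dot (M *m u) (M *m v) = dot u v.
Proof.
have dotE m (a b : 'cV[R]_m) : dot a b = (a^T *m b) 0 0.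
  by rewrite mxE; apply: eq_bigr => i _; rewrite mxE.
by move=> hM; rewrite !dotE trmx_mul -mulmxA (mulmxA _ M) hM mul1mx.
Qed.

Lemma dot_perturb m (a b da db : 'cV[R]_m) (s s' e e' : R) :
  enorm a <= s -> enorm b <= s' -> enorm da <= e -> enorm db <= e' ->
  `|dot (a + da) (b + db) - dot a b| <= s * e' + e * s' + e * e'.
Proof.
move=> ha hb hda hdb.
have le_prod (u v : 'cV[R]_m) p q : enorm u <= p -> enorm v <= q ->
    `|dot u v| <= p * q.
  move=> up vq; apply: le_trans (normr_dot_le u v) _.
  by rewrite ler_pM ?enorm_ge0.
have -> : dot (a + da) (b + db) - dot a b = dot a db + dot da b + dot da db.
  by rewrite dotDl !dotDr; ring.
apply: le_trans (ler_normD _ _) _; apply: lerD; last exact: le_prod.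
by apply: le_trans (ler_normD _ _) _; apply: lerD; exact: le_prod.
Qed.

End EuclideanTheory.

(** * Gram matrix of the examples on the good event *)

Section ClusterGeometry.
Context (R : realType) (D d : nat) (tau : R).
Hypotheses (d_gt0 : (0 < d)%N) (tau_gt0 : 0 < tau).

(** With [s = sqrt x], [ln x = 2 (ln (s / 2) + ln 2) <= 2 ((s / 2 - 1) + 1) = s]. *)
Lemma ln_le_sqrt (x : R) : 1 <= x -> ln x <= Num.sqrt x.
Proof.
move=> x1; have x0 : 0 < x by rewrite (lt_le_trans _ x1).
set s := Num.sqrt x; have s0 : 0 < s by rewrite sqrtr_gt0.
have -> : x = s * s by rewrite -expr2 sqr_sqrtr// ltW.
have half : ln (s / 2) <= s / 2 - 1.
  have := @le_ln1Dx R (s / 2 - 1); rewrite [1 + _]addrC subrK; apply; lra.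
have ln2 : ln 2 <= 1 :> R by apply: (@le_ln1Dx R 1); lra.
have sE : ln s = ln (s / 2) + ln 2.
  by rewrite -lnM ?posrE ?divr_gt0// divfK.
by rewrite lnM ?posrE//; lra.
Qed.

(** The radicand is a perfect square. The right-hand side is the bound on [|omega| + |zeta|]. *)
Lemma zeta_barE : zeta_bar D tau = 1 + tau * Num.sqrt (13 * D%:R / 8).
Proof.
have q0 : 0 <= 13 * D%:R / 8 :> R by rewrite divr_ge0// mulr_ge0.
rewrite /zeta_bar -[RHS]ger0_norm -?sqrtr_sqr; last first.
  by rewrite addr_ge0// mulr_ge0 ?sqrtr_ge0// ltW.
congr Num.sqrt; have := sqr_sqrtr q0; set s := Num.sqrt _ => sE.
have -> : 13 * D%:R * tau ^+ 2 / 8 = tau ^+ 2 * s ^+ 2 by rewrite sE; ring.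
ring.
Qed.

Lemma sqrt2_ge : 14 / 10 <= Num.sqrt 2 :> R.
Proof.
have p0 : 0 <= 14 / 10 :> R by lra.
by rewrite -(@ler_pXn2r _ 2) ?nnegrE ?sqrtr_ge0// sqr_sqrtr; lra.
Qed.

(* [M *m u + eta] is within [c2 * sqrt d] of [eta], and [eta] has norm at most
   [zeta_bar]. *)
Lemma example_gram (M : 'M[R]_(D, d)) (mu mu' xi xi' : 'cV[R]_d)
    (zeta zeta' omega omega' : 'cV[R]_D) :
  M^T *m M = 1%:M ->
  enorm mu = Num.sqrt d%:R -> enorm mu' = Num.sqrt d%:R ->
  enorm xi <= Num.sqrt 2 * ln d%:R -> enorm xi' <= Num.sqrt 2 * ln d%:R ->
  dot zeta zeta <= 13 / 8 * D%:R * tau ^+ 2 ->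
  dot zeta' zeta' <= 13 / 8 * D%:R * tau ^+ 2 ->
  enorm omega <= 1 -> enorm omega' <= 1 ->
  `|dot (example M mu zeta xi omega) (example M mu' zeta' xi' omega')
    - dot mu mu'| <= Delta' D d tau.
Proof.
move=> hM hmu hmu' hxi hxi' hz hz' hw hw'.
have d1 : 1 <= d%:R :> R by rewrite ler1n.
set s := Num.sqrt d%:R in hmu hmu' *; set q := Num.sqrt 2 in hxi hxi' *.
set l := ln d%:R in hxi hxi' *.
have s0 : 0 <= s by exact: sqrtr_ge0.
have l0 : 0 <= l by exact: ln_ge0.
have ls : l <= s by exact: ln_le_sqrt.
have q0 : 0 <= q by exact: sqrtr_ge0.
have q2 : q ^+ 2 = 2 by rewrite sqr_sqrtr.
have normM (u : 'cV[R]_d) : enorm (M *m u) = enorm u.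
  by rewrite /enorm dot_isometry.
have le_u (m x : 'cV[R]_d) : enorm m = s -> enorm x <= q * l ->
    enorm (M *m (m + x)) <= c2 R * s.
  move=> hm hx; rewrite normM (le_trans (enormD _ _))// hm /c2 -/q.
  by nra.
have le_eta (z o : 'cV[R]_D) : dot z z <= 13 / 8 * D%:R * tau ^+ 2 ->
    enorm o <= 1 -> enorm (z + o) <= zeta_bar D tau.
  move=> hz1 ho; rewrite (le_trans (enormD _ _))// zeta_barE addrC lerD//.
  rewrite -[tau]ger0_norm ?(ltW tau_gt0)// -sqrtr_sqr -sqrtrM ?sqr_ge0//.
  rewrite /enorm ler_wsqrtr// (le_trans hz1)//.
  by rewrite le_eqVlt; apply/orP; left; apply/eqP; field.
(* Adding shift and noise to the embedded points costs [epsilon_x]. *)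
have outer := dot_perturb (le_u _ _ hmu hxi) (le_u _ _ hmu' hxi')
  (le_eta _ _ hz hw) (le_eta _ _ hz' hw').
have emu : enorm mu <= s by rewrite hmu.
have emu' : enorm mu' <= s by rewrite hmu'.
(* Adding [xi] to the means costs [2 q s l + 2 l^2], at most [Delta] because [l <= s]. *)
have inner := dot_perturb emu emu' hxi hxi'.
rewrite dot_isometry// in outer.
rewrite /example -!(addrA (M *m _)) /Delta' /epsilon_x.
set x := dot _ _ in outer *; set y := dot _ _ in outer inner.
rewrite -(subrK y x) -addrA (le_trans (ler_normD _ _))//.
rewrite [leRHS]addrC; apply: lerD.
  by rewrite (le_trans outer)// -/s le_eqVlt; apply/orP; left; apply/eqP; ring.
by rewrite (le_trans inner)// /Delta /c2 -/q -/s -/l; nra.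
Qed.

(** From [zeta_bar >= 1] and [c2 >= 24/10] in [epsilon_x]. It turns (A2) into a lower bound on the
    dimension. *)
Lemma Delta'_ge : 1 + 48 / 10 * Num.sqrt d%:R <= Delta' D d tau.
Proof.
have d1 : 1 <= d%:R :> R by rewrite ler1n.
have l0 : 0 <= ln d%:R :> R by exact: ln_ge0.
have s0 : 0 <= Num.sqrt d%:R :> R by exact: sqrtr_ge0.
have c2ge : 24 / 10 <= c2 R by rewrite /c2; have := sqrt2_ge; lra.
have z1 : 1 <= zeta_bar D tau.
  by rewrite zeta_barE lerDl mulr_ge0 ?sqrtr_ge0// ltW.
have Dl : 0 <= Delta R d by rewrite /Delta !mulr_ge0//; lra.
have zs : Num.sqrt d%:R <= zeta_bar D tau * Num.sqrt d%:R.
  by rewrite ler_peMl.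
have zz : 1 <= zeta_bar D tau ^+ 2 by rewrite exprn_ege1.
rewrite /Delta' /epsilon_x; nra.
Qed.

End ClusterGeometry.

(* The partition of [n] is given by the cluster map cl, I^(r) = cl^-1(r).
   The noise vectors, the test example and the KKT point may depend on the
   outcome t of the random shifts in an arbitrary, possibly non-measurable, way;
   hence the probability bound is on a measurable event E contained in the
   set of outcomes for which the claim holds. *)
Theorem theorem4p1 (R : realType) (D d k n w : nat)
    (hd : (1 <= d)%N) (hdD : (d <= D)%N) (hk : (2 <= k)%N)
    (disp : measure_display) (T : measurableType disp) (P : probability T R)
    (y : 'I_k -> R) (hy : forall r, y r = 1 \/ y r = -1)
    (mu : 'I_k -> 'cV[R]_d)
    (M : 'M[R]_(D, d)) (hM : M^T *m M = 1%:M)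
    (tau : R) (htau : 0 < tau)
    (zeta : 'I_k -> {RV P >-> D.-tuple (measurableTypeR R)})
    (hgauss : forall r, isotropic_gaussian tau (zeta r))
    (hindep : mutually_independent zeta)
    (cl : 'I_n -> 'I_k) (hcl : forall r, exists i, cl i = r)
    (xi : T -> 'I_n -> 'cV[R]_d) (omega : T -> 'I_n -> 'cV[R]_D)
    (A1 : forall r, enorm (mu r) = Num.sqrt d%:R)
    (A2 : exists2 c' : R, 0 < c' < 1 / 10 &
       k%:R * (max_corr mu + Delta' D d tau + 1) =
         c' * (d%:R - Delta' D d tau + 1))
    (A3 : forall t i,
       enorm (xi t i) <= Num.sqrt 2 * ln d%:R /\ enorm (omega t i) <= 1)
    (A4 : 0 < c3 D d k tau /\ 0 < c5 d k tau)
    (theta : T -> network R D w)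
    (r : 'I_k) (xi0 : T -> 'cV[R]_d) (omega0 : T -> 'cV[R]_D)
    (hnice : forall t,
       enorm (xi0 t) <= Num.sqrt 2 * ln d%:R /\ enorm (omega0 t) <= 1) :
  exists E : set T,
    [/\ measurable E,
        ((1 - 2 * expR (- (D%:R / 16)))%:E <= P E)%E
      & forall t, E t ->
          is_kkt (fun i => example M (mu (cl i)) (col_of_tuple (zeta (cl i) t))
                             (xi t i) (omega t i))
                 (fun i => y (cl i)) (theta t) ->
          Num.sg (net_eval (theta t)
                    (example M (mu r) (col_of_tuple (zeta r t))
                       (xi0 t) (omega0 t))) = y r].
Proof.
have [c' /andP[c0 c1] kB] := A2.
have d0 : 0 < d%:R :> R by rewrite ltr0n.
have s0 : 0 < Num.sqrt d%:R :> R by rewrite sqrtr_gt0.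
have sE : Num.sqrt d%:R ^+ 2 = d%:R :> R by rewrite sqr_sqrtr ?ltW.
have k2 : 2 <= k%:R :> R by rewrite ler_nat.
have D'ge := Delta'_ge D hd htau.
set D' := Delta' D d tau in kB D'ge.
have p0 : 0 <= max_corr mu by exact: bigmax_ge_id.
set p := max_corr mu in kB p0.
set A := d%:R - D' + 1 in kB; set B := p + D' + 1 in kB.
have B0 : 0 < B by rewrite /B; nra.
have A0 : 0 < A.
  by rewrite -(pmulr_rgt0 _ c0) -kB mulr_gt0//; lra.
have kD' : k%:R * (D' + 1) <= 1 / 10 * A.
  apply: (@le_trans _ _ (k%:R * B)); first by rewrite ler_wpM2l// /B; lra.
  by rewrite kB ler_wpM2r// ltW.
(* As [D' >= 1], [A <= d]; hence [k * (48/10) * sqrt d <= k * D' <= d / 10], and one divides by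
   [sqrt d]. *)
have kD : 48 * k%:R <= Num.sqrt D%:R :> R.
  apply: (@le_trans _ _ (Num.sqrt d%:R)); last by rewrite ler_wsqrtr// ler_nat.
  rewrite -(ler_pM2r s0) -expr2 sE.
  have : k%:R * (48 / 10 * Num.sqrt d%:R) <= k%:R * D' by rewrite ler_wpM2l//; lra.
  by rewrite /A in kD'; nra.
exists (sqnorms_le zeta (13 / 8 * D%:R * tau ^+ 2)); split.
- exact: measurable_sqnorms_le.
- apply: le_trans (probability_sqnorms_le htau _ hgauss); last by lra.
  by rewrite lee_fin lerB// chernoff_union_bound.
move=> t Et [lambda [phi' [lam0 sub stat feas slack]]].
(* Stated for arbitrary noise, to serve both the training examples and the test example. *)
have near q xi' om' : enorm xi' <= Num.sqrt 2 * ln d%:R -> enorm om' <= 1 ->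
    gram_near (fun i => example M (mu (cl i)) (col_of_tuple (zeta (cl i) t))
                          (xi t i) (omega t i)) cl A B (d%:R + D' + 1)
      q (example M (mu q) (col_of_tuple (zeta q t)) xi' om').
  move=> hxi hom i; have [hxi' hom'] := A3 t i.
  have := example_gram hd htau hM (A1 (cl i)) (A1 q) hxi' hxi
    (Et (cl i)) (Et q) hom' hom.
  rewrite ler_norml -/D' => /andP[lo up].
  have [iq|iq] := eqVneq (cl i) q.
    move: lo up; rewrite iq -[dot (mu q) _]sqr_enorm A1 sE => lo up.
    by rewrite /A; apply/andP; split; lra.
  have pge : `|dot (mu (cl i)) (mu q)| <= p.
    exact: (@le_bigmax_cond _ _ _ 0 (cl i, q) (fun ij => ij.1 != ij.2)
      (fun ij => `|dot (mu ij.1) (mu ij.2)|)).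
  move: pge; rewrite !ler_norml /B => /andP[p1 p2].
  by apply/andP; split; lra.
have [hxi0 hom0] := hnice t.
suff N0 : 0 < y r * net_eval (theta t) (example M (mu r)
    (col_of_tuple (zeta r t)) (xi0 t) (omega0 t)).
  move: N0; have [->|->] := hy r; first by rewrite mul1r => /gtr0_sg.
  by rewrite mulN1r oppr_gt0 => /ltr0_sg.
apply: (kkt_margin_gt0 (B := B) (C := d%:R + D' + 1) (c := c') hy lam0 sub
  (fun j => let: And3 h _ _ := stat j in h)
  (fun j => let: And3 _ h _ := stat j in h) A0 _ _ _ feas slack) => //.
- exact: ltW.
- by lra.
- by move=> i; have [hxi hom] := A3 t i; exact: near.
- by rewrite c1 ltW.
(* The upper Gram bound exceeds [A] by exactly [2 * D'], which is at most [k * B = c' * A] since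
   [k >= 2]. *)
- have : 2 * D' <= k%:R * B by rewrite ler_pM//; rewrite /B; lra.
  by rewrite kB /A; lra.
- exact: near.
Qed.
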